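(* For the linear matroid secretary problem on laminar matroids, there is a choice of the parameter $p\in(0,1)$ for which the algorithm $\mathrm{ONLINE}$ (described in the context) is $9.6$-competitive: for every laminar matroid $(U,\mathcal{I})$ and every non-negative weight function $w:U\to\mathbb{R}_{\ge0}$, with $f(T)=\sum_{e\in T}w(e)$, the output satisfies $\mathrm{ALG}\in\mathcal{I}$ and $\mathbb{E}[f(\mathrm{ALG})]\ge \frac{1}{9.6}\max_{T\in\mathcal{I}}f(T)$.
   Context: Setting: finite ground set $U$, $n=|U|$, laminar matroid $(U,\mathcal{I})$: a laminar family $\mathcal{F}$ of subsets of $U$ (any two members disjoint or nested) with integer capacities $\mu(B)$, and $\mathcal{I}=\{T: |T\cap B|\le \mu(B)\ \forall B\in\mathcal{F}\}$. The elements arrive in uniformly random order; each element must be irrevocably accepted or rejected upon arrival; the algorithm learns an element's weight only when it arrives. For $T\subseteq U$ and $e\in U$ write $f_T(e)=f(T\cup\{e\})-f(T)$. $\mathrm{GREEDY}(H)$ for $H\subseteq U$: start with $T=\emptyset$; while there is $e\in H\setminus T$ with $T\cup\{e\}\in\mathcal{I}$, add to $T$ such an $e$ maximizing $f_T(e)$ (ties broken by a fixed rule); return $T$. $\mathrm{ONLINE}$ with parameter $p$: set $M,N,\mathrm{ALG}=\emptyset$; draw $m\sim\mathrm{Binom}(n,p)$; observe (and reject) the first $m$ arriving elements, forming the set $H$; set $M=\mathrm{GREEDY}(H)$. For each subsequent arriving element $e$: if $\mathrm{GREEDY}(H\cup\{e\})\ne\mathrm{GREEDY}(H)$, then add $e$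 to $N$, and if moreover $\mathrm{ALG}\cup\{e\}\in\mathcal{I}$, accept $e$ (add it to $\mathrm{ALG}$); otherwise reject $e$. *)

(* Defs.v *)
From HB Require Import structures.
From mathcomp Require Import all_boot all_order all_algebra.
Set Implicit Arguments. Unset Strict Implicit. Unset Printing Implicit Defensive.
Import Order.TTheory GRing.Theory Num.Theory.
Local Open Scope ring_scope.

Section Secretary.
Variables (R : realFieldType) (U : finType).

Definition laminar (F : {set {set U}}) : bool :=
  [forall A in F, forall B in F,
     [|| A \subset B, B \subset A | [disjoint A & B]]].

Definition lam_indep (F : {set {set U}}) (mu : {set U} -> nat) (T : {set U}) : bool :=
  [forall B in F, #|T :&: B| <= mu B]%N.

Definition linf (w : U -> R) (T : {set U}) : R := \sum_(e in T) w e.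

Variables (indep : {set U} -> bool) (f : {set U} -> R) (rk : U -> nat).

Definition marg (T : {set U}) (e : U) : R := f (e |: T) - f T.

Definition better (T : {set U}) (e e' : U) : bool :=
  (marg T e' < marg T e) || ((marg T e == marg T e') && (rk e <= rk e')%N).

Definition greedy_step (H T : {set U}) : {set U} :=
  let C := [set e in H :\: T | indep (e |: T)] in
  if [pick e in C | [forall e' in C, better T e e']] is Some e
  then e |: T else T.

(* GREEDY(H): each non-final step adds an element, so #|U| iterations
   reach the fixpoint where no further element can be added. *)
Definition greedy (H : {set U}) : {set U} := iter #|U| (greedy_step H) set0.

Definition online (s : seq U) (m : nat) : {set U} :=
  let H := [set x in take m s] in
  let G := greedy H in
  foldl (fun ALG e =>
           if (greedy (e |: H) != G) && indep (e |: ALG) then e |: ALG else ALG)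
        set0 (drop m s).

(* E[f(ALG)]: uniform random arrival order, independent m ~ Binom(n,p). *)
Definition expected_online (p : R) : R :=
  let n := #|U| in
  (\sum_(s <- permutations (enum U))
     \sum_(m < n.+1)
       ('C(n, m)%:R * p ^+ m * (1 - p) ^+ (n - m)) * f (online s m))
  / (n`!)%:R.

End Secretary.

(* Main.v *)
Require Import Defs.
From HB Require Import structures.
From mathcomp Require Import all_boot all_order all_fingroup all_algebra.
From mathcomp Require Import ring lra zify.
Set Implicit Arguments. Unset Strict Implicit. Unset Printing Implicit Defensive.
Import Order.TTheory GRing.Theory Num.Theory.
Local Open Scope ring_scope.

(** Take [p = 5/6]. The sample [H] contains each element independently with
    probability [p]. Reading [U] by decreasing weight and tossing a coin for
    each element [e] that keeps [M] independent puts [e] into [M = GREEDY(H)]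
    (heads, probability [p]) or into the set [N] of selectable elements
    (tails), so [E[w(N)] = (1-p)/p * E[w(M)] >= (1-p) * OPT], because greedy is
    optimal on [H].

    Discard each capacity set that lies in a larger one of at most the same
    capacity; then the capacities of the sets containing a given element are
    distinct. An element [e] of [N] is rejected only if some remaining [B]
    containing [e] has [mu B] elements of [N :&: B] arriving before [e], which
    given [H] has probability [ell (mu B) #|N :&: B|]. A potential function of
    [h = #|M :&: B|] and [t = #|N :&: B|] bounds the expected weight lost
    through [B] by [loss (mu B) * E[w(N :&: B)]], where the constants satisfy
    [\sum_k loss k <= 3/8]. Hence [E[w(ALG)] >= (1/6) * (5/8) * OPT = OPT / 9.6]. *)

(** * Random subsets and coin tosses *)

Lemma setU1I_mem (U : finType) (e : U) (A B : {set U}) :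
  e \in B -> (e |: A) :&: B = e |: (A :&: B).
Proof. by move=> eB; apply/setP=> x; rewrite !inE; case: eqP => // ->; rewrite eB. Qed.

Lemma setU1I_notin (U : finType) (e : U) (A B : {set U}) :
  e \notin B -> (e |: A) :&: B = A :&: B.
Proof.
move=> eB; apply/setP=> x; rewrite !inE; case: eqP => // ->.
by rewrite (negbTE eB) !andbF.
Qed.

Section RandomSubset.
Variables (R : realFieldType) (U : finType) (p : R).

Definition subset_prob (H : {set U}) : R :=
  \prod_(x : U) (if x \in H then p else 1 - p).

Lemma subset_prob_ge0 H : 0 <= p <= 1 -> 0 <= subset_prob H.
Proof.
by case/andP=> p0 p1; apply: prodr_ge0 => x _; case: ifP => // _; rewrite subr_ge0.
Qed.

Lemma subset_probE H : subset_prob H = p ^+ #|H| * (1 - p) ^+ (#|U| - #|H|).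
Proof.
have -> : (#|U| - #|H| = #|~: H|)%N by rewrite [RHS]cardsCs setCK.
rewrite /subset_prob (bigID (mem H)) /= -!prodr_const.
congr (_ * _); first by apply: eq_bigr => x ->.
apply: eq_big => x; first by rewrite inE.
by move/negbTE->.
Qed.

Lemma sum_subset_prob : \sum_(H : {set U}) subset_prob H = 1.
Proof.
rewrite /subset_prob -(bigA_distr _ _ (fun=> p) (fun=> 1 - p)) big1 // => i _.
by rewrite /= addrC subrK.
Qed.

(** Conditioning on the coin of [e]: the last two hypotheses say that [A] and [B] ignore this coin,
    so its factor splits off from [subset_prob], and [H] without [e] is paired with [e |: H]. *)
Lemma expect_split (e : U) (F A B : {set U} -> R) :
  (forall H, F H = if e \in H then A H else B H) ->
  (forall H, A (e |: H) = A H) -> (forall H, B (e |: H) = B H) ->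
  \sum_(H : {set U}) subset_prob H * F H =
  p * (\sum_(H : {set U}) subset_prob H * A H) +
  (1 - p) * (\sum_(H : {set U}) subset_prob H * B H).
Proof.
move=> FE Ae Be.
pose Q (H : {set U}) : R := \prod_(x | x != e) (if x \in H then p else 1 - p).
have PQ H : subset_prob H = (if e \in H then p else 1 - p) * Q H.
  by rewrite /subset_prob (bigD1 e).
have Qe H : Q (e |: H) = Q H.
  by apply: eq_bigr => x /negbTE xe; rewrite !inE xe.
have half (C : {set U} -> R) : (forall H, C (e |: H) = C H) ->
    \sum_(H : {set U} | e \in H) Q H * C H = \sum_(H : {set U} | e \notin H) Q H * C H.
  move=> Ce; rewrite (reindex_onto (fun H => e |: H) (fun H => H :\ e)) /=; last first.
    by move=> H eH; rewrite setD1K.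
  apply: eq_big => [H|H _]; last by rewrite Ce Qe.
  rewrite !inE eqxx /=; apply/eqP/idP => [<-|eH]; first by rewrite !inE eqxx.
  by apply/setP=> x; rewrite !inE; case: eqP => // ->; rewrite (negbTE eH).
have tot (C : {set U} -> R) : (forall H, C (e |: H) = C H) ->
    \sum_(H : {set U}) subset_prob H * C H = \sum_(H : {set U} | e \notin H) Q H * C H.
  move=> Ce; rewrite (bigID (fun H : {set U} => e \in H)) /=.
  rewrite (eq_bigr (fun H => p * (Q H * C H))); last by move=> H eH; rewrite PQ eH mulrA.
  rewrite [X in _ + X](eq_bigr (fun H => (1 - p) * (Q H * C H))); last first.
    by move=> H /negbTE eH; rewrite PQ eH mulrA.
  by rewrite -!mulr_sumr half // -mulrDl addrC subrK mul1r.
rewrite (tot A) // (tot B) // (bigID (fun H : {set U} => e \in H)) /= -half //.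
rewrite !mulr_sumr; congr (_ + _); apply: eq_bigr => H eH; rewrite PQ FE ?eH ?mulrA //.
by rewrite (negbTE eH).
Qed.

Lemma expect_linf (w : U -> R) (T : {set U}) :
  \sum_(H : {set U}) subset_prob H * linf w (T :&: H) = p * linf w T.
Proof.
rewrite /linf mulr_sumr.
transitivity (\sum_(H : {set U}) \sum_(e in T)
   subset_prob H * (if e \in H then w e else 0)).
  apply: eq_bigr => H _; rewrite -mulr_sumr; congr (_ * _).
  by rewrite -big_mkcondr /=; apply: eq_bigl => e; rewrite inE.
rewrite exchange_big; apply: eq_bigr => e _.
rewrite (@expect_split e _ (fun=> w e) (fun=> 0)) //.
by rewrite -!mulr_suml sum_subset_prob mulr0 mulr0 addr0 mul1r.
Qed.

End RandomSubset.

(** * The greedy scan as a sequence of coin tosses *)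

Section Scan.
Variables (R : realFieldType) (U : finType) (indep : {set U} -> bool) (p : R).

Fixpoint scan (l : seq U) (H M N : {set U}) : {set U} * {set U} :=
  if l is e :: l' then
    if indep (e |: M) then
      if e \in H then scan l' H (e |: M) N else scan l' H M (e |: N)
    else scan l' H M N
  else (M, N).

Fixpoint scan_mean (g : {set U} * {set U} -> R) (l : seq U) (M N : {set U}) : R :=
  if l is e :: l' then
    if indep (e |: M) then
      p * scan_mean g l' (e |: M) N + (1 - p) * scan_mean g l' M (e |: N)
    else scan_mean g l' M N
  else g (M, N).

Lemma scan_setU1 e l H M N : e \notin l -> scan l (e |: H) M N = scan l H M N.
Proof.
elim: l M N => //= x l IH M N; rewrite inE negb_or => /andP[xe el].
by rewrite !IH // !inE eq_sym (negbTE xe).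
Qed.

(** Deferred decisions: since [l] has no repetition, the coin of its head is never read again, so it
    may be tossed when the scan reaches it. *)
Lemma expect_scan g l M N : uniq l ->
  \sum_(H : {set U}) subset_prob p H * g (scan l H M N) = scan_mean g l M N.
Proof.
elim: l M N => [|e l IH] M N /=; first by rewrite -mulr_suml sum_subset_prob mul1r.
case/andP=> el ul; case: ifP => _; last exact: IH.
rewrite (@expect_split _ _ _ e _ (fun H => g (scan l H (e |: M) N))
  (fun H => g (scan l H M (e |: N)))) ?IH //.
- by move=> H; case: ifP.
- by move=> H; rewrite scan_setU1.
- by move=> H; rewrite scan_setU1.
Qed.

Lemma linf_setU1 (w : U -> R) e (A : {set U}) :
  e \notin A -> linf w (e |: A) = w e + linf w A.
Proof. by move=> eA; rewrite /linf big_setU1. Qed.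

(** The quantity is a martingale: a toss at [e] changes it by [- (1 - p) * w e] with probability [p]
    and by [p * w e] with probability [1 - p]. *)
Lemma scan_mean_balance (w : U -> R) l (M N : {set U}) :
  uniq l -> {in l, forall e, (e \notin M) && (e \notin N)} ->
  scan_mean (fun MN => p * linf w MN.2 - (1 - p) * linf w MN.1) l M N =
  p * linf w N - (1 - p) * linf w M.
Proof.
elim: l M N => //= e l IH M N /andP[el ul] fresh.
have /andP[eM eN] := fresh e (mem_head _ _).
have fr x : x \in l -> (x == e = false) * (x \notin M) * (x \notin N).
  move=> xl; have /andP[-> ->] : (x \notin M) && (x \notin N).
    by apply: fresh; rewrite inE xl orbT.
  by split=> //; split => //; apply: contraNF el => /eqP <-.
case: ifP => _; last by apply: IH => // x /fr xE; rewrite !xE.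
rewrite !IH //; last 2 first.
- by move=> x /fr xE; rewrite !inE !xE.
- by move=> x /fr xE; rewrite !inE !xE.
by rewrite !linf_setU1 //; ring.
Qed.

End Scan.

(* [ell mu s]: the chance that a given one of [s] items in uniformly random
   order is preceded by at least [mu] of the others (truncated subtraction and
   [0 / 0 = 0] give [0] for [s <= mu]). *)
Definition ell (R : realFieldType) (mu s : nat) : R := (s - mu)%:R / s%:R.

(** In state [(h, t)], [h] heads and [t] tails have been seen in a set of capacity [mu]. [lam h t]
    bounds the expected final value of [ell]; [phi h t] bounds the expected loss beyond the allowed
    rate [c] on tails still to come, per unit of the largest weight left. A new tail brings the
    excess [lam h t.+1 - c]. *)
Record certificate (R : realFieldType) (p : R) (mu : nat) (c : R)
    (lam phi : nat -> nat -> R) : Prop := Certificate {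
  cert_ell : forall h t, (h <= mu)%N -> ell R mu t <= lam h t;
  cert_lam : forall h t, (h < mu)%N ->
    (1 - p) * lam h t.+1 + p * lam h.+1 t <= lam h t;
  cert_phi : forall h t, (h < mu)%N ->
    (1 - p) * (lam h t.+1 - c) + (1 - p) * phi h t.+1 + p * phi h.+1 t <= phi h t;
  cert_phi_ge0 : forall h t, (h <= mu)%N -> 0 <= phi h t;
  cert_phi0 : phi 0%N 0%N = 0 }.

(** * A supermartingale for the loss at one capacity set *)

Section Potential.
Variables (R : realFieldType) (U : finType) (indep : {set U} -> bool) (p : R).
Variables (w : U -> R) (B : {set U}) (mu : nat) (c : R) (lam phi : nat -> nat -> R).
Hypothesis p01 : 0 <= p <= 1.
Hypothesis w_ge0 : forall e, 0 <= w e.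
Hypothesis indepB : forall T, indep T -> (#|T :&: B| <= mu)%N.
Hypothesis cert : certificate p mu c lam phi.

(* The conditions on a certificate say that the right-hand side is a
   supermartingale, where [om] bounds the weights still to come. *)
Lemma scan_mean_potential l (M N : {set U}) om : indep M ->
  uniq l -> {in l, forall e, (e \notin M) && (e \notin N)} ->
  sorted (fun x y => w y <= w x) l -> 0 <= om -> {in l, forall e, w e <= om} ->
  scan_mean indep p (fun MN => linf w (MN.2 :&: B) * (ell R mu #|MN.2 :&: B| - c)) l M N
  <= linf w (N :&: B) * (lam #|M :&: B| #|N :&: B| - c)
     + om * phi #|M :&: B| #|N :&: B|.
Proof.
have [p0 p1] := andP p01; have linf0 A : 0 <= linf w A by apply: sumr_ge0.
elim: l M N om => [|e l IH] M N om iM /=.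
  move=> _ _ _ om0 _; rewrite -[leLHS]addr0; apply: lerD.
    by apply: ler_wpM2l => //; rewrite lerD2r (cert_ell cert) ?indepB.
  by rewrite mulr_ge0 ?(cert_phi_ge0 cert) ?indepB.
move=> /andP[el ul] fresh srt om0 wom.
have /andP[eM eN] := fresh e (mem_head _ _).
have fr x : x \in l -> (x == e = false) * (x \notin M) * (x \notin N).
  move=> xl; have /andP[-> ->] : (x \notin M) && (x \notin N).
    by apply: fresh; rewrite inE xl orbT.
  by split=> //; split => //; apply: contraNF el => /eqP <-.
have trw : transitive (fun x y : U => w y <= w x).
  by move=> y x z yx zy; exact: le_trans zy yx.
have wl : {in l, forall x, w x <= w e}.
  by move=> x xl; have /allP := order_path_min trw srt; apply.
have srt' : sorted (fun x y => w y <= w x) l by apply: path_sorted srt.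
have weom : w e <= om by apply: wom; rewrite mem_head.
have frM : {in l, forall x, (x \notin e |: M) && (x \notin N)}.
  by move=> x /fr xE; rewrite !inE !xE.
have frN : {in l, forall x, (x \notin M) && (x \notin e |: N)}.
  by move=> x /fr xE; rewrite !inE !xE.
have fr0 : {in l, forall x, (x \notin M) && (x \notin N)}.
  by move=> x /fr xE; rewrite !xE.
case: ifP => ieM; last first.
  by apply: IH => // x xl; apply: le_trans (wl _ xl) _.
have q0 : 0 <= 1 - p by rewrite subr_ge0.
have [eB|eB] := boolP (e \in B); last first.
  have H1 : (e |: M) :&: B = M :&: B by apply: setU1I_notin.
  have H2 : (e |: N) :&: B = N :&: B by apply: setU1I_notin.
  have wo x : x \in l -> w x <= om by move=> xl; apply: le_trans (wl _ xl) _.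
  have I1 := IH (e |: M) N om ieM ul frM srt' om0 wo.
  have I2 := IH M (e |: N) om iM ul frN srt' om0 wo.
  rewrite H1 in I1; rewrite H2 in I2.
  apply: le_trans (lerD (ler_wpM2l p0 I1) (ler_wpM2l q0 I2)) _.
  by rewrite -mulrDl addrC subrK mul1r.
(* Later weights are at most [w e], so the bound drops from [om] to [w e]. The terms then group into
   the weight of old tails, handled by [cert_lam], and multiples of [w e], handled by [cert_phi]. *)
have I1 := IH (e |: M) N (w e) ieM ul frM srt' (w_ge0 e) wl.
have I2 := IH M (e |: N) (w e) iM ul frN srt' (w_ge0 e) wl.
have H1 : (e |: M) :&: B = e |: (M :&: B) by apply: setU1I_mem.
have H2 : (e |: N) :&: B = e |: (N :&: B) by apply: setU1I_mem.
have eMB : e \notin M :&: B by rewrite inE (negbTE eM).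
have eNB : e \notin N :&: B by rewrite inE (negbTE eN).
have hmu : (#|M :&: B| < mu)%N.
  by have := indepB ieM; rewrite H1 cardsU1 eMB.
rewrite H1 cardsU1 eMB add1n in I1; rewrite H2 cardsU1 eNB add1n linf_setU1 // in I2.
apply: le_trans (lerD (ler_wpM2l p0 I1) (ler_wpM2l q0 I2)) _.
have C1 := ler_wpM2l (linf0 (N :&: B)) (cert_lam cert #|N :&: B| hmu).
have C2 := ler_wpM2l (w_ge0 e) (cert_phi cert #|N :&: B| hmu).
have C3 : w e * phi #|M :&: B| #|N :&: B| <= om * phi #|M :&: B| #|N :&: B|.
  by apply: ler_wpM2r => //; rewrite (cert_phi_ge0 cert) // ltnW.
apply: le_trans (lerD (lexx _) C3); move: C1 C2.
set W := linf w _; set h := #|_|; set t := #|_|; clearbody W h t => C1 C2.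
set X := (X in X <= _); set Y := (Y in _ <= Y).
have -> : X = W * ((1 - p) * lam h t.+1 + p * lam h.+1 t) - W * c +
  w e * ((1 - p) * (lam h t.+1 - c) + (1 - p) * phi h t.+1 + p * phi h.+1 t).
  by rewrite /X; ring.
have -> : Y = W * lam h t - W * c + w e * phi h t by rewrite /Y; ring.
by rewrite lerD // lerD2r.
Qed.

End Potential.

(** * Certificates for a single capacity *)

Section Certificates.
Local Open Scope nat_scope.

Definition ceil_div (a b : nat) : nat := (a + b.-1) %/ b.

(* The tables solve the backward recursions of a certificate for [p = 5/6],
   scaled by [1000] and rounded up. Row [h], column [t] is the state [(h, t)];
   from column [10] on, [lam = 1000] (every tail is lost) and
   [phi = (mu - h) * d], where [d] bounds the loss of the expected [1/5] tails
   per remaining head. *)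
Definition back_row (step : nat -> nat -> nat) (far : nat) : nat -> seq nat :=
  fix row k := if k is k'.+1 then
    let r := row k' in step (10 - k) (head far r) :: r else [::].

Fixpoint lam_rows (mu k : nat) : seq (seq nat) :=
  if k is k'.+1 then
    let rs := lam_rows mu k' in
    let prev := head [::] rs in
    back_row (fun t next => ceil_div (next + 5 * nth 1000 prev t) 6) 1000 10 :: rs
  else [:: [seq ceil_div (1000 * (t - mu)) t | t <- iota 0 10]].

Fixpoint phi_rows (mu c d k : nat) : seq (seq nat) :=
  if k is k'.+1 then
    let rs := phi_rows mu c d k' in
    let prev := head [::] rs in
    let lrow := head [::] (lam_rows mu k) in
    back_row (fun t next =>
      ceil_div (nth 1000 lrow t.+1 + next + 5 * nth (k' * d) prev t - c) 6) (k * d) 10 :: rs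
  else [:: nseq 10 0].

Definition lam_tab mu h t := nth 1000 (nth [::] (lam_rows mu mu) h) t.
Definition phi_tab mu c d h t := nth ((mu - h) * d) (nth [::] (phi_rows mu c d mu) h) t.

(** The certificate conditions with denominators cleared, tested on the columns below [10]; the row
    lengths are tested too, so that beyond them [nth] returns its default. *)
Definition check_tab mu c :=
  let d := ceil_div (1000 - c) 5 in
  let L := lam_rows mu mu in
  let P := phi_rows mu c d mu in
  let lam h t := nth 1000 (nth [::] L h) t in
  let phi h t := nth ((mu - h) * d) (nth [::] P h) t in
  [&& all (fun r => size r == 10) L, all (fun r => size r == 10) P,
      size L == mu.+1, size P == mu.+1,
      all (fun h => all (fun t => 1000 * (t - mu) <= lam h t * t) (iota 0 10)) (iota 0 mu.+1),
      all (fun h => all (fun t =>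
        (lam h t.+1 + 5 * lam h.+1 t <= 6 * lam h t) &&
        (lam h t.+1 + phi h t.+1 + 5 * phi h.+1 t <= 6 * phi h t + c))
          (iota 0 10)) (iota 0 mu) & phi 0 0 == 0].

Definition loss_table : seq nat := [:: 0; 170; 70; 35; 20; 12; 10; 10].

Lemma check_tab_ok : all (fun k => check_tab k (nth 0 loss_table k)) (iota 0 8).
Proof. by vm_compute. Qed.

Lemma ceil_divP a b : 0 < b -> a <= b * ceil_div a b.
Proof.
by move=> b0; rewrite /ceil_div; move: (divn_eq (a + b.-1) b) (ltn_pmod (a + b.-1) b0); lia.
Qed.

Lemma check_tabP mu c : check_tab mu c ->
  let d := ceil_div (1000 - c) 5 in
  [/\ forall h t, h <= mu -> t > 0 -> 1000 * (t - mu) <= lam_tab mu h t * t,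
      forall h t, h < mu ->
        lam_tab mu h t.+1 + 5 * lam_tab mu h.+1 t <= 6 * lam_tab mu h t,
      forall h t, h < mu ->
        lam_tab mu h t.+1 + phi_tab mu c d h t.+1 + 5 * phi_tab mu c d h.+1 t
          <= 6 * phi_tab mu c d h t + c &
      phi_tab mu c d 0 0 = 0].
Proof.
move=> + d; rewrite /check_tab -/d => /and5P[/allP sL /allP sP /eqP zL /eqP zP].
case/and3P=> /allP okL /allP okS /eqP ok0.
have farL h t : h <= mu -> 10 <= t -> lam_tab mu h t = 1000.
  move=> hm t10; rewrite /lam_tab nth_default //.
  by rewrite (eqP (sL _ _)) // mem_nth // zL ltnS.
have farP h t : h <= mu -> 10 <= t -> phi_tab mu c d h t = (mu - h) * d.
  move=> hm t10; rewrite /phi_tab nth_default //.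
  by rewrite (eqP (sP _ _)) // mem_nth // zP ltnS.
(* In the far columns the condition on [phi] reduces to this: a head, of relative weight [5], lowers
   [phi] by [d], and this pays the excess of a tail. *)
have dP : 1000 - c <= 5 * d by apply: ceil_divP.
split=> //.
- move=> h t hm t0; have [t10|t10] := ltnP t 10; last by rewrite farL // leq_mul2l leq_subr orbT.
  by apply: (allP (okL h _)); rewrite mem_iota.
- move=> h t hm; have [t10|t10] := ltnP t 10.
    by have /andP[] := allP (okS h ltac:(by rewrite mem_iota)) t ltac:(by rewrite mem_iota).
  by rewrite !farL //; lia.
- move=> h t hm; have [t10|t10] := ltnP t 10.
    by have /andP[] := allP (okS h ltac:(by rewrite mem_iota)) t ltac:(by rewrite mem_iota).
  rewrite farL ?farP //; [|lia..].
  have -> : mu - h = (mu - h.+1).+1 by lia.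
  by rewrite mulSn; set x := (_ * d)%N; clearbody x; lia.
Qed.

End Certificates.

(** * Loss constants and their certificates *)

Section Losses.
Variable R : realFieldType.

(** The closed form is too large for small capacities, as it sums to [5 / 2] over all [mu >= 1];
    hence the table below [8]. *)
Definition loss (mu : nat) : R :=
  if (mu < 8)%N then (nth 0 loss_table mu)%N%:R / 1000%:R
  else 2%:R * (5%:R / 9%:R) ^+ mu.

Lemma loss_ge0 mu : 0 <= loss mu.
Proof.
rewrite /loss; case: ifP => _; first by rewrite divr_ge0 ?ler0n.
by rewrite mulr_ge0 ?ler0n // exprn_ge0 // divr_ge0 ?ler0n.
Qed.

Lemma sum_loss L : \sum_(k < L) loss k <= 3%:R / 8%:R.
Proof.
(* The subtracted term is the whole geometric tail still to be added; reserving it makes the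
   induction close. *)
suff tail n : \sum_(k < 8 + n) loss k <= 3%:R / 8%:R - 9%:R / 2%:R * (5%:R / 9%:R) ^+ (8 + n).
  apply: (@le_trans _ _ (\sum_(k < 8 + L) loss k)).
    rewrite -!(big_mkord xpredT loss) [leRHS](@big_cat_nat _ _ _ L) //= ?leq_addl //.
    by rewrite lerDl; apply: sumr_ge0 => k _; apply: loss_ge0.
  apply: (le_trans (tail L)); rewrite gerBl.
  by rewrite mulr_ge0 ?exprn_ge0 ?divr_ge0 ?ler0n.
elim: n => [|n IH].
  by rewrite addn0 !big_ord_recr big_ord0 /loss /= !exprS expr0; lra.
rewrite addnS big_ord_recr /= exprS.
have -> : loss (8 + n) = 2%:R * (5%:R / 9%:R) ^+ (8 + n) by rewrite /loss ltnNge leq_addr.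
by move: IH; set x := _ ^+ _; clearbody x; lra.
Qed.

Lemma loss_small_certificate mu : (mu < 8)%N ->
  exists lam phi, certificate (5%:R / 6%:R : R) mu (loss mu) lam phi.
Proof.
move=> mu8; have := allP check_tab_ok mu; rewrite mem_iota mu8 => /(_ isT).
rewrite /loss mu8; set c := nth 0%N _ _; move/check_tabP.
set d := ceil_div _ _; case=> okE okL okP ok0.
exists (fun h t => (lam_tab mu h t)%:R / 1000%:R).
exists (fun h t => (phi_tab mu c d h t)%:R / 1000%:R); split.
- move=> h t hm; rewrite /ell; case: (posnP t) => [->|t0].
    by rewrite sub0n mul0r divr_ge0 ?ler0n.
  rewrite ler_pdivrMr ?ltr0n // mulrAC ler_pdivlMr ?ltr0n // -!natrM ler_nat mulnC.
  exact: okE.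
- move=> h t hm; have := okL h t hm; rewrite -(ler_nat R) natrD !natrM; lra.
- move=> h t hm; have := okP h t hm; rewrite -(ler_nat R).
  by rewrite natrD (natrD _ (lam_tab _ _ _)) (natrD _ (6 * _)) !natrM; lra.
- by move=> h t _; rewrite divr_ge0 ?ler0n.
- by rewrite ok0 mul0r.
Qed.

(* Tilting by [3 ^ t * (3 / 5) ^ h] turns the biased coin into a fair one, so
   the expected number of remaining flips, [2 * (mu - h)], bounds the loss. *)
Lemma loss_large_certificate mu : (8 <= mu)%N ->
  exists lam phi, certificate (5%:R / 6%:R : R) mu (loss mu) lam phi.
Proof.
move=> mu8; rewrite /loss ltnNge mu8 /=.
pose lam h t : R := (3%:R * mu.+1%:R)^-1 * 3%:R ^+ t / 3%:R ^+ mu * (5%:R / 3%:R) ^+ (mu - h).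
(* Half of the expected [2 * (mu - h)] tilted flips are tails, which gives the factor [mu - h]. At
   the start the value is lowered to [0], as [cert_phi0] demands. *)
pose phi h t : R := if (h == 0)%N && (t == 0)%N then 0 else (mu - h)%:R * lam h t.
have lam_ge0 h t : 0 <= lam h t.
  by rewrite /lam !mulr_ge0 ?invr_ge0 ?exprn_ge0 ?mulr_ge0 ?invr_ge0 ?ler0n.
have lamT h t : lam h t.+1 = 3%:R * lam h t by rewrite /lam exprS; ring.
have lamH h t : (h < mu)%N -> lam h.+1 t = 3%:R / 5%:R * lam h t.
  move=> hm; rewrite /lam; have -> : (mu - h = (mu - h.+1).+1)%N by lia.
  rewrite exprS; set x := _ ^+ (mu - _); clearbody x.
  set y := _ / 3%:R ^+ mu; clearbody y; lra.
exists lam, phi; split.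
- move=> h t hm; rewrite /ell; have [tm|tm] := leqP t mu.
    by move: (tm); rewrite -subn_eq0 => /eqP->; rewrite mul0r.
  apply: (@le_trans _ _ ((3%:R * mu.+1%:R)^-1 * 3%:R ^+ t / 3%:R ^+ mu)); last first.
    rewrite /lam ler_peMr //; last by apply: exprn_ege1; lra.
    by rewrite !mulr_ge0 ?invr_ge0 ?exprn_ge0 ?mulr_ge0 ?invr_ge0 ?ler0n.
  have [k tE] : exists k, t = (mu + k.+1)%N by exists (t - mu).-1; lia.
  rewrite tE addKn exprD ler_pdivrMr ?ltr0n ?addnS //.
  have e0 : (3%:R ^+ mu : R) != 0 by rewrite expf_neq0 // pnatr_eq0.
  have -> : (3%:R * mu.+1%:R)^-1 * (3%:R ^+ mu * 3%:R ^+ k.+1) / 3%:R ^+ mu * (mu + k).+1%:R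
     = (3%:R ^+ k.+1 * (mu + k).+1%:R) / (3%:R * mu.+1%:R) :> R.
    by field; rewrite e0 andbT nat1r pnatr_eq0.
  rewrite ler_pdivlMr ?mulr_gt0 ?ltr0n // -natrX -!natrM ler_nat expnS.
  have k3 : (k.+1 <= 3 ^ k)%N by apply: ltn_expl.
  rewrite mulnCA -mulnA leq_mul2l /=; apply: leq_mul => //; lia.
- by move=> h t hm; rewrite lamT lamH //; lra.
- move=> h t hm; have E1 : phi h t.+1 = (mu - h)%:R * lam h t.+1 by rewrite /phi andbF.
  have E2 : phi h.+1 t = ((mu - h)%:R - 1) * lam h.+1 t.
    by rewrite /phi /= subnS -subn1 natrB // subn_gt0.
  rewrite E1 E2 lamT lamH //; set m := (mu - h)%:R.
  (* The allowance [(1 - p) * c = (5 / 9) ^ mu / 3] is spent only at [(0, 0)], where it covers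
     [mu * lam 0 0]. Elsewhere the inequality holds with that much to spare. *)
  have [/andP[/eqP h0 /eqP t0]|nz] := boolP ((h == 0)%N && (t == 0)%N).
    rewrite /phi h0 t0 eqxx /= /m h0 subn0.
    have -> : lam 0%N 0%N = (3%:R * mu.+1%:R)^-1 * (5%:R / 9%:R) ^+ mu.
      rewrite /lam subn0 expr0 mulr1 -mulrA; congr (_ * _).
      rewrite -exprVn -exprMn; congr (_ ^+ _); field; lra.
    have x0 : 0 <= (5%:R / 9%:R : R) ^+ mu by rewrite exprn_ge0 // divr_ge0 ?ler0n.
    have y1 : mu%:R * (3%:R * mu.+1%:R)^-1 <= 3%:R^-1 :> R.
      by rewrite ler_pdivrMr ?mulr_gt0 ?ltr0n // mulKf ?pnatr_eq0 // ler_nat.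
    have := ler_wpM2r x0 y1; set x := _ ^+ _; set y := (_ * _)^-1; clearbody x y.
    set z := mu%:R; clearbody z => yz.
    have -> : (1 - 5%:R / 6%:R) * (3%:R * (y * x) - 2%:R * x) +
      (1 - 5%:R / 6%:R) * (z * (3%:R * (y * x))) +
      5%:R / 6%:R * ((z - 1) * (3%:R / 5%:R * (y * x))) = z * y * x - 3%:R^-1 * x by field; lra.
    by rewrite subr_le0.
  have -> : phi h t = m * lam h t by rewrite /phi (negbTE nz).
  have : 0 <= (5%:R / 9%:R : R) ^+ mu by rewrite exprn_ge0 // divr_ge0 ?ler0n.
  set x := _ ^+ _; set y := lam _ _; clearbody m x y => x0.
  rewrite -subr_ge0; set D := (D in 0 <= D).
  have -> : D = 3%:R^-1 * x by rewrite /D; field; lra.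
  by rewrite mulr_ge0 ?invr_ge0 ?ler0n.
- move=> h t hm; rewrite /phi; case: ifP => // _; by rewrite mulr_ge0 ?ler0n.
- by rewrite /phi.
Qed.

Lemma loss_certificate mu :
  exists lam phi, certificate (5%:R / 6%:R : R) mu (loss mu) lam phi.
Proof.
by case: (ltnP mu 8) => [/loss_small_certificate|/loss_large_certificate].
Qed.

End Losses.

(** * The greedy algorithm *)

Section WeightOrder.
Variables (R : realFieldType) (U : finType) (w : U -> R) (rk : U -> nat).
Hypothesis rk_inj : injective rk.

Definition heavier (e e' : U) : bool :=
  (w e' < w e) || ((w e == w e') && (rk e <= rk e')%N).

Lemma heavier_total : total heavier.
Proof.
move=> x y; rewrite /heavier; case: (ltgtP (w x) (w y)) => //= _.
by rewrite leq_total.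
Qed.

Lemma heavier_trans : transitive heavier.
Proof.
move=> y x z; rewrite /heavier.
case/orP=> [xy|/andP[/eqP xy rxy]] /orP[yz|/andP[/eqP yz ryz]].
- by rewrite (lt_trans yz xy).
- by rewrite -yz xy.
- by rewrite xy yz.
- by rewrite xy yz eqxx (leq_trans rxy ryz) orbT.
Qed.

Lemma heavier_anti : antisymmetric heavier.
Proof.
move=> x y; rewrite /heavier; case: (ltgtP (w x) (w y)) => //= _.
by rewrite -eqn_leq => /eqP/rk_inj.
Qed.

Definition by_weight : seq U := sort heavier (enum U).
Definition weight_pos (e : U) : nat := index e by_weight.

Lemma mem_by_weight e : e \in by_weight.
Proof. by rewrite mem_sort mem_enum. Qed.

Lemma by_weight_uniq : uniq by_weight.
Proof. by rewrite sort_uniq enum_uniq. Qed.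

Lemma by_weight_sorted : sorted (fun x y => w y <= w x) by_weight.
Proof.
apply: (@sub_sorted _ heavier); last exact: (sort_sorted heavier_total).
by move=> x y /orP[/ltW|/andP[/eqP-> _]].
Qed.

Local Notation pos := weight_pos.

Lemma pos_inj : injective pos.
Proof. by move=> x y; apply: (index_inj x); apply: mem_by_weight. Qed.

Lemma heavierE x y : heavier x y = (pos x <= pos y)%N.
Proof.
have hp a b : (pos a <= pos b)%N -> heavier a b.
  apply: (sorted_leq_index heavier_trans); rewrite ?mem_by_weight //.
    by move=> z; rewrite /heavier eqxx leqnn orbT.
  exact: (sort_sorted heavier_total).
apply/idP/idP => [xy|]; last exact: hp.
rewrite leqNgt; apply/negP => yx.
have E : x = y by apply: heavier_anti; rewrite xy hp // ltnW.
by move: yx; rewrite E ltnn.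
Qed.

End WeightOrder.

(** * Greedy as a scan in order of decreasing weight *)

Section Greedy.
Variables (R : realFieldType) (U : finType) (w : U -> R) (rk : U -> nat).
Variable indep : {set U} -> bool.
Hypothesis rk_inj : injective rk.
Hypothesis indep0 : indep set0.
Hypothesis indepS : forall A B : {set U}, A \subset B -> indep B -> indep A.

Local Notation pos := (weight_pos w rk).
Local Notation l := (by_weight w rk).
Local Notation greedy := (greedy indep (linf w) rk).

Definition before (G : {set U}) (e : U) : {set U} := [set x in G | (pos x < pos e)%N].

Definition greedy_spec (H G : {set U}) : Prop :=
  forall e, (e \in G) = (e \in H) && indep (e |: before G e).

(** Whether an element is taken depends only on earlier positions, by induction on the position.
    Hence adding [e] to the sample changes nothing before [e]. *)
Lemma greedy_spec_local H H' G G' e :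
  greedy_spec H G -> greedy_spec H' G' ->
  (forall x, (pos x < pos e)%N -> (x \in H) = (x \in H')) ->
  before G e = before G' e.
Proof.
move=> sG sG' HH'; apply/setP=> x; rewrite !inE.
suff: forall n x, (pos x < n)%N -> (pos x < pos e)%N -> (x \in G) = (x \in G').
  move=> /(_ _ x (ltnSn _)); case: ltnP => xe; last by rewrite !andbF.
  by move=> ->.
elim=> // n IH {}x; rewrite ltnS => xn xe; rewrite sG sG' HH' //.
congr (_ && indep (_ |: _)); apply/setP=> y; rewrite !inE.
case: ltnP => yx; rewrite ?andbF // !andbT; apply: IH; first exact: leq_trans yx xn.
exact: ltn_trans yx xe.
Qed.

Lemma greedy_spec_uniq H G G' : greedy_spec H G -> greedy_spec H G' -> G = G'.
Proof.
move=> sG sG'; apply/setP=> e; rewrite sG sG'.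
by rewrite (greedy_spec_local (e := e) sG sG').
Qed.

Lemma marg_linf (T : {set U}) e : e \notin T -> marg (linf w) T e = w e.
Proof. by move=> eT; rewrite /marg linf_setU1 // addrK. Qed.

Let cand H (T : {set U}) := [set e in H :\: T | indep (e |: T)].

Lemma greedy_stepP H T :
  (cand H T = set0 /\ greedy_step indep (linf w) rk H T = T) \/
  (exists2 e, e \in cand H T & (forall x, x \in cand H T -> (pos e <= pos x)%N) /\
     greedy_step indep (linf w) rk H T = e |: T).
Proof.
have candT x : x \in cand H T -> x \notin T by rewrite !inE -andbA => /and3P[].
have betterE x y : x \in cand H T -> y \in cand H T ->
    better (linf w) rk T x y = (pos x <= pos y)%N.
  by move=> /candT xT /candT yT; rewrite /better !marg_linf // -(heavierE w rk_inj).
rewrite /greedy_step -/(cand H T); case: pickP => [e /andP[eC /forall_inP eB]|no].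
  by right; exists e => //; split=> // x xC; rewrite -betterE // eB.
left; split=> //; apply/eqP; rewrite -subset0; apply/subsetP=> x xC.
case: (arg_minnP pos xC) => e eC' emin.
have eC : e \in cand H T by [].
have := no e; rewrite eC /= => /negbT/negP[].
by apply/forall_inP=> y yC; rewrite betterE // emin.
Qed.

(** The last clause says that an element overtaken by a later one is blocked by accepted elements
    before it alone; this persists because [before T e] only grows with [T]. *)
Definition greedy_inv (H T : {set U}) : Prop :=
  [/\ T \subset H, indep T &
   forall e x, e \in H -> e \notin T -> x \in T -> (pos e < pos x)%N ->
     ~~ indep (e |: before T e)].

Lemma before_all (T : {set U}) e :
  e \notin T -> (forall x, x \in T -> ~~ (pos e < pos x)%N) -> before T e = T.
Proof.
move=> eT all_before; apply/setP=> x; rewrite inE; case: (boolP (x \in T)) => //= xT.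
have := all_before x xT; rewrite -leqNgt leq_eqVlt => /orP[/eqP/pos_inj E|//].
by rewrite -E xT in eT.
Qed.

Lemma beforeS (T T' : {set U}) e : T \subset T' -> before T e \subset before T' e.
Proof.
by move=> /subsetP sT; apply/subsetP=> x; rewrite !inE => /andP[/sT-> ->].
Qed.

Lemma greedy_inv_step H T : greedy_inv H T -> greedy_inv H (greedy_step indep (linf w) rk H T).
Proof.
case=> TH iT blocked; case: (greedy_stepP H T) => [[_ ->]//|[e eC [emin ->]]].
move: (eC); rewrite !inE -andbA => /and3P[eT eH ieT].
split=> //; first by rewrite subUset sub1set eH.
move=> x y xH; rewrite !inE negb_or => /andP[xe xT] yT xy.
have sub : x |: before T x \subset x |: before (e |: T) x.
  by apply: setUS; apply: beforeS; apply: subsetUr.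
apply: contra (indepS sub) _.
have [/existsP[z /andP[zT xz]]|] := boolP [exists z, (z \in T) && (pos x < pos z)%N].
  exact: blocked xz.
rewrite negb_exists => /forallP none.
have E : before T x = T.
  by apply: before_all => // z zT; have := none z; rewrite zT.
(* Here [x] is overtaken for the first time, by the new element. Were it feasible, it would be a
   candidate of smaller position than the one chosen. *)
rewrite E; case/orP: yT => [/eqP yE|yT]; last by have := none y; rewrite yT xy.
apply/negP => ixT; have xC : x \in cand H T by rewrite !inE xT xH.
by have := emin x xC; rewrite leqNgt -yE xy.
Qed.

Lemma greedy_inv_iter H n : greedy_inv H (iter n (greedy_step indep (linf w) rk H) set0).
Proof.
elim: n => [|n IH]; last exact: greedy_inv_step.
by split=> //; [exact: sub0set | move=> e x _ _; rewrite inE].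
Qed.

Lemma greedy_indep H : indep (greedy H).
Proof. by case: (greedy_inv_iter H #|U|). Qed.

Lemma greedy_specP H : greedy_spec H (greedy H).
Proof.
pose T n := iter n (greedy_step indep (linf w) rk H) set0.
have grow n : cand H (T n) = set0 \/ (n <= #|T n|)%N.
  elim: n => [|n IH]; first by right.
  rewrite /T iterS -/(T n); case: (greedy_stepP H (T n)) => [[C0 ->]|[e eC [_ ->]]].
    by left.
  right; case: IH => [C0|IH]; first by rewrite C0 inE in eC.
  by move: eC; rewrite !inE -andbA cardsU1 => /andP[-> _].
have C0 : cand H (greedy H) = set0.
  case: (grow #|U|) => // full; apply/eqP; rewrite -subset0; apply/subsetP=> x.
  have /eqP TT : T #|U| == setT by rewrite eqEcard subsetT cardsT.
  by rewrite /greedy -/(T #|U|) TT !inE.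
case: (greedy_inv_iter H #|U|); rewrite -/(greedy H) => GH iG blocked e.
have [eG|eG] := boolP (e \in greedy H).
  rewrite (subsetP GH) //=; apply/esym; apply: indepS iG.
  by rewrite subUset sub1set eG; apply/subsetP=> x; rewrite inE => /andP[].
case: (boolP (e \in H)) => //= eH; apply/esym/negbTE.
have [/existsP[z /andP[zT xz]]|] := boolP [exists z, (z \in greedy H) && (pos e < pos z)%N].
  exact: blocked xz.
rewrite negb_exists => /forallP none.
rewrite before_all //; last by move=> z zT; have := none z; rewrite zT.
apply/negP => ie; have : e \in cand H (greedy H) by rewrite !inE eG eH.
by rewrite C0 inE.
Qed.

Definition selectable (H : {set U}) : {set U} :=
  [set e | (e \notin H) && indep (e |: before (greedy H) e)].

(** Greedy acts alike on [H] and [e |: H] up to [e]. If [e] is blocked there, [greedy H] still meets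
    the specification for [e |: H], and uniqueness applies. *)
Lemma greedy_changesE (H : {set U}) e : e \notin H ->
  (greedy (e |: H) != greedy H) = (e \in selectable H).
Proof.
move=> eH; rewrite inE eH /=; have sG := greedy_specP H; have sG' := greedy_specP (e |: H).
have loc : before (greedy (e |: H)) e = before (greedy H) e.
  apply: (greedy_spec_local sG' sG) => x xe; rewrite !inE.
  by case: eqP xe => // ->; rewrite ltnn.
have [ie|ie] := boolP (indep _).
  apply/eqP => E; have := sG' e; rewrite loc ie !inE eqxx /= E.
  by rewrite sG (negbTE eH).
apply/negbTE; rewrite negbK; apply/eqP.
apply: (greedy_spec_uniq sG') => x; rewrite !inE; case: eqP => [->|_] /=; last exact: sG.
by rewrite (negbTE ie) sG (negbTE eH).
Qed.

(** When the scan reads [e], its set [M] is [before (greedy H) e], so its test is the one in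
    [greedy_spec] and [selectable]. *)
Lemma scan_greedy H : scan indep l H set0 set0 = (greedy H, selectable H).
Proof.
have sG := greedy_specP H.
suff gen l2 l1 : l = l1 ++ l2 ->
    scan indep l2 H (greedy H :&: [set x in l1]) (selectable H :&: [set x in l1])
    = (greedy H, selectable H).
  have := gen l [::] erefl; have -> : [set x in [::]] = set0 :> {set U}.
    by apply/setP=> x; rewrite !inE.
  by rewrite !setI0.
elim: l2 l1 => [|e l2 IH] l1 lE /=.
  have -> : [set x in l1] = setT.
    by apply/setP=> x; rewrite !inE -[l1]cats0 -lE mem_by_weight.
  by rewrite !setIT.
have := by_weight_uniq w rk; rewrite lE cat_uniq /= => /and3P[_ /norP[el1 _] _].
have pe : pos e = size l1.
  by rewrite /weight_pos lE index_cat (negbTE el1) /= eqxx addn0.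
have bE : before (greedy H) e = greedy H :&: [set x in l1].
  apply/setP=> x; rewrite !inE pe; congr (_ && _).
  rewrite /weight_pos lE index_cat; case: ifP => xl1; first by rewrite index_mem.
  by apply/negbTE; rewrite -leqNgt leq_addr.
have IHe := IH (rcons l1 e); rewrite cat_rcons in IHe; have {}IHe := IHe lE.
have setE (A : {set U}) : A :&: [set x in rcons l1 e] =
    if e \in A then e |: (A :&: [set x in l1]) else A :&: [set x in l1].
  apply/setP=> x; case: ifP => eA; rewrite !inE mem_rcons inE; case: eqP => //= ->.
    by rewrite eA.
  by rewrite eA.
move: IHe; rewrite !setE sG [e \in selectable H]inE -bE.
by case: (indep _); rewrite ?andbF ?andbT //; case: (e \in H).
Qed.

End Greedy.

(** * Laminar families *)

Section Laminar.
Variables (U : finType) (F : {set {set U}}) (mu : {set U} -> nat).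
Local Open Scope nat_scope.

Lemma lam_indep0 : lam_indep F mu set0.
Proof. by apply/forall_inP=> B _; rewrite set0I cards0. Qed.

Lemma lam_indepS (A B : {set U}) : A \subset B -> lam_indep F mu B -> lam_indep F mu A.
Proof.
move=> sAB /forall_inP iB; apply/forall_inP=> C CF.
by apply: leq_trans (iB C CF); rewrite subset_leq_card // setSI.
Qed.

Hypothesis lamF : laminar F.

Lemma laminarP A B : A \in F -> B \in F ->
  [|| A \subset B, B \subset A | [disjoint A & B]].
Proof. by move=> AF BF; apply: (forall_inP (forall_inP lamF A AF)). Qed.

(* Beyond [M], the set [J] only has elements of tight sets; the maximal tight
   sets are disjoint, and none of them contains more of [J] than of [M]. *)
Lemma blocked_card (M J : {set U}) :
  lam_indep F mu M -> lam_indep F mu J ->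
  (forall e, e \in J -> e \notin M -> ~~ lam_indep F mu (e |: M)) ->
  #|J| <= #|M|.
Proof.
move=> /forall_inP iM /forall_inP iJ blocked.
pose tight (B : {set U}) := (B \in F) && (mu B <= #|M :&: B|).
pose D := [set B | maxset tight B].
have DP B : B \in D -> tight B by rewrite inE => /maxsetp.
have trivD : trivIset D.
  apply/trivIsetP=> A B AD BD AB; have /andP[AF _] := DP _ AD; have /andP[BF _] := DP _ BD.
  move: (AD) (BD); rewrite !inE => /maxsetP[tA mA] /maxsetP[tB mB].
  case/or3P: (laminarP AF BF) => // [/mA|/mB] E; by rewrite E ?eqxx // in AB *.
have cardI (A : {set U}) : #|A :&: cover D| = \sum_(B in D) #|A :&: B|.
  have cnt (C : {set U}) : #|A :&: C| = \sum_(x in C) (x \in A : nat).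
    rewrite -sum1_card big_mkcond [RHS]big_mkcond; apply: eq_bigr => x _.
    by rewrite inE andbC; case: (x \in C); case: (x \in A).
  by rewrite cnt big_trivIset //; apply: eq_bigr => B _; rewrite cnt.
rewrite -(cardsID (cover D) J) -(cardsID (cover D) M); apply: leq_add.
  rewrite !cardI; apply: leq_sum => B BD; have /andP[BF tB] := DP _ BD.
  exact: leq_trans (iJ B BF) tB.
apply: subset_leq_card; apply/subsetP=> e; rewrite !inE => /andP[eD eJ].
rewrite eD /=; apply: contraR eD => eM.
have := blocked e eJ eM; rewrite negb_forall => /existsP[B]; rewrite negb_imply -ltnNge.
case/andP=> BF; have [eB|eB] := boolP (e \in B); last first.
  have -> : (e |: M) :&: B = M :&: B by apply: setU1I_notin.
  by rewrite ltnNge iM.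
have -> : (e |: M) :&: B = e |: (M :&: B) by apply: setU1I_mem.
rewrite cardsU1 inE (negbTE eM) /= add1n ltnS => tB.
have [A mA BA] := @maxset_exists _ tight B ltac:(by rewrite /tight BF).
by apply/bigcupP; exists A; rewrite ?inE // (subsetP BA).
Qed.

Definition essential : {set {set U}} :=
  [set B in F | [forall B' in F, (B \proper B') ==> (mu B < mu B')]].

(** A maximal superset of [B] among the members of capacity at most [mu B] is essential, and its
    constraint implies that of [B]. *)
Lemma lam_indep_essential T : lam_indep F mu T = lam_indep essential mu T.
Proof.
apply/forall_inP/forall_inP => [iT B|iT B BF].
  by rewrite inE => /andP[/iT].
pose P (X : {set U}) := (X \in F) && (mu X <= mu B).
have [A mA BA] := @maxset_exists _ P B ltac:(by rewrite /P BF leqnn).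
have /maxsetP[/andP[AF muA] maxA] := mA.
apply: leq_trans (muA); apply: leq_trans (iT A _).
  by rewrite subset_leq_card // setIS.
rewrite inE AF; apply/forall_inP=> C CF; apply/implyP=> AC; rewrite ltnNge.
apply/negP => muC; have := maxA C ltac:(by rewrite /P CF (leq_trans muC muA)) (proper_sub AC).
by move=> E; rewrite E properxx in AC.
Qed.

(** Two members sharing [e] are nested, and a proper inclusion between essential sets strictly
    increases the capacity. *)
Lemma essential_inj e :
  {in [pred B : {set U} | (B \in essential) && (e \in B)] &, injective mu}.
Proof.
move=> A B /andP[Aess eA] /andP[Bess eB] muAB.
move: Aess Bess; rewrite !inE => /andP[AF /forall_inP mA] /andP[BF /forall_inP mB].
apply/eqP; rewrite eqEsubset; apply/andP.
case/or3P: (laminarP AF BF) => [sAB|sBA|/pred0P/(_ e)]; last by rewrite /= eA eB.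
- split=> //; apply: contraT => nBA.
  by have := mA B BF; rewrite /proper sAB nBA muAB ltnn.
- split=> //; apply: contraT => nAB.
  by have := mB A AF; rewrite /proper sBA nAB muAB ltnn.
Qed.

End Laminar.

Lemma sum_injective_le (R : realFieldType) (I : finType) (P : pred I) (m : I -> nat)
    (c : nat -> R) (C : R) :
  {in P &, injective m} -> (forall k, 0 <= c k) ->
  (forall L, \sum_(k < L) c k <= C) -> \sum_(i | P i) c (m i) <= C.
Proof.
move=> m_inj c0 sumC; pose L := (\max_i m i).+1.
have mL i : (m i < L)%N by rewrite ltnS; apply: leq_bigmax.
apply: le_trans (sumC L); pose g i := Ordinal (mL i).
have -> : \sum_(i | P i) c (m i) = \sum_(i in [set i | P i]) c (g i).
  by apply: eq_bigl => i; rewrite inE.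
rewrite -(big_imset (fun k : 'I_L => c k)) /=; last first.
  by move=> i j; rewrite !inE => Pi Pj [E]; exact: m_inj.
rewrite [leLHS]big_mkcond; apply: ler_sum => k _; by case: ifP.
Qed.

(* Abel summation, with [D] the surplus carried from the prefix already read. *)
Lemma sum_le_of_prefix_counts (R : realFieldType) (U : eqType) (w : U -> R) (a b : pred U)
    (l : seq U) (D : nat) (om : R) :
  (forall e, 0 <= w e) -> sorted (fun x y => w y <= w x) l ->
  {in l, forall e, w e <= om} -> 0 <= om ->
  (forall k, count b (take k l) <= D + count a (take k l))%N ->
  \sum_(x <- l | b x) w x <= D%:R * om + \sum_(x <- l | a x) w x.
Proof.
move=> w0; have trw : transitive (fun x y : U => w y <= w x).
  by move=> y x z yx zy; exact: le_trans zy yx.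
elim: l D om => [|x l IH] D om /= srt wom om0 cnt.
  by rewrite !big_nil addr0 mulr_ge0 ?ler0n.
have bD : (b x <= D + a x)%N by have := cnt 1%N; rewrite /= take0 /= !addn0.
have := IH (D + a x - b x)%N (w x) (path_sorted srt) _ (w0 x) _.
have H1 : {in l, forall e, w e <= w x} by apply/allP; exact: order_path_min srt.
have H2 k : (count b (take k l) <= D + a x - b x + count a (take k l))%N.
  by have := cnt k.+1; rewrite /=; lia.
move=> /(_ H1 H2); rewrite natrB // natrD => IHx.
have wx : D%:R * w x <= D%:R * om by apply: ler_wpM2l; rewrite ?ler0n ?wom ?mem_head.
by rewrite !big_cons; case: (a x) (b x) IHx => [] [] /=; rewrite ?mulr1n ?mulr0n; lra.
Qed.

(** * Optimality of greedy on the sample *)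

Section GreedyOptimal.
Variables (R : realFieldType) (U : finType) (F : {set {set U}}) (mu : {set U} -> nat).
Variables (w : U -> R) (rk : U -> nat) (indep : {set U} -> bool).
Hypothesis lamF : laminar F.
Hypothesis w_ge0 : forall e, 0 <= w e.
Hypothesis rk_inj : injective rk.
Hypothesis indepE : forall T, indep T = lam_indep F mu T.

(** In every prefix of the weight order, an element of [T] missed by greedy is blocked by greedy's
    choices in that prefix, so [blocked_card] compares the counts and Abel summation the weights. *)
Lemma greedy_optimal (H T : {set U}) : indep T -> T \subset H ->
  linf w T <= linf w (greedy indep (linf w) rk H).
Proof.
move=> iT TH; set G := greedy _ _ _ _; pose l := by_weight w rk.
have indep0 : indep set0 by rewrite indepE lam_indep0.
have indepS (A B : {set U}) : A \subset B -> indep B -> indep A.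
  by rewrite !indepE; apply: lam_indepS.
have sG : greedy_spec w rk indep H G by apply: greedy_specP.
have iG : indep G by apply: greedy_indep.
have linfE (A : {set U}) : linf w A = \sum_(x <- l | x \in A) w x.
  have pl : perm_eq l (enum U) by rewrite perm_sort.
  by rewrite (perm_big _ pl) big_enum_cond.
have cntE (A : {set U}) k : count (mem A) (take k l) = #|A :&: [set x in take k l]|.
  rewrite -size_filter -(card_uniqP _) ?filter_uniq ?take_uniq ?by_weight_uniq //.
  by apply: eq_card => x; rewrite !inE mem_filter.
have abel := @sum_le_of_prefix_counts R U w (mem G) (mem T) l 0%N (\sum_x w x) w_ge0.
rewrite mul0r add0r in abel; rewrite !linfE; apply: abel.
- exact: by_weight_sorted.
- by move=> e _; rewrite (bigD1 e) //= lerDl sumr_ge0.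
- exact: sumr_ge0.
move=> k; rewrite add0n !cntE; apply: (blocked_card lamF (mu := mu)).
- by rewrite -indepE; apply: indepS iG; apply: subsetIl.
- by rewrite -indepE; apply: indepS iT; apply: subsetIl.
move=> e; rewrite !inE => /andP[eT ek]; rewrite ek andbT => eG.
have := sG e; rewrite (negbTE eG) (subsetP TH) //= => /esym/negbT.
rewrite -indepE; apply: contra; apply: indepS; apply: setUS; apply/subsetP=> x.
rewrite !inE => /andP[-> xe] /=.
have ul := by_weight_uniq w rk.
have posE y : (y \in take k l) = (index y l < k)%N.
  by rewrite in_take ?mem_by_weight.
by rewrite posE; rewrite posE in ek; exact: ltn_trans xe ek.
Qed.

End GreedyOptimal.

(** * Uniformly random arrival order *)

Section RandomOrder.
Variables (R : realFieldType) (U : finType).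

Lemma permutations_prefix (H : {set U}) :
  perm_eq [seq s <- permutations (enum U) | [set x in take #|H| s] == H]
    [seq a ++ b | a <- permutations (enum H), b <- permutations (enum (~: H))].
Proof.
have sizeH a : a \in permutations (enum H) -> size a = #|H|.
  by rewrite mem_permutations => /perm_size ->; rewrite -cardE.
apply: uniq_perm.
- by rewrite filter_uniq // permutations_uniq.
- apply: allpairs_uniq; rewrite ?permutations_uniq //.
  move=> _ _ /allpairsP[[a b] /= [aP _ ->]] /allpairsP[[a' b'] /= [aP' _ ->]] /= /eqP.
  by rewrite eqseq_cat ?sizeH // => /andP[/eqP-> /eqP->].
move=> s; rewrite mem_filter mem_permutations; apply/andP/allpairsP.
- case=> /eqP sH sU; have us : uniq s by rewrite (perm_uniq sU) enum_uniq.
  have := us; rewrite -{1}(cat_take_drop #|H| s) cat_uniq => /and3P[ut /hasPn dis ud].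
  exists (take #|H| s, drop #|H| s); rewrite /= cat_take_drop !mem_permutations; split=> //.
    by apply: uniq_perm; rewrite ?enum_uniq // => x; rewrite mem_enum -[in RHS]sH inE.
  apply: uniq_perm; rewrite ?enum_uniq // => x; rewrite mem_enum inE -[in RHS]sH inE.
  apply/idP/idP => [/dis//|xt]; have : x \in s by rewrite (perm_mem sU) mem_enum.
  by rewrite -{1}(cat_take_drop #|H| s) mem_cat (negbTE xt).
- case=> -[a b] /= [aP bP ->]; rewrite take_size_cat ?sizeH //.
  move: aP bP; rewrite !mem_permutations => aP bP; split.
    by apply/eqP/setP=> x; rewrite inE (perm_mem aP) mem_enum.
  apply: perm_trans (perm_cat aP bP) _; apply: uniq_perm; rewrite ?enum_uniq //.
    rewrite cat_uniq !enum_uniq andbT /=; apply/hasPn => x.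
    by rewrite !mem_enum inE.
  by move=> x; rewrite mem_cat !mem_enum !inE orbN.
Qed.

(** A given [H] of size [m] is the set of first arrivals in [m! (n - m)!] of the [n!] orders, which
    cancels the binomial coefficient. Thus a binomial [m] makes the sample a set of independent
    tosses, and the rest arrives in uniform order. *)
Lemma expected_prefix (p : R) (g : {set U} -> seq U -> R) :
  (\sum_(s <- permutations (enum U)) \sum_(m < #|U|.+1)
     ('C(#|U|, m)%:R * p ^+ m * (1 - p) ^+ (#|U| - m)) * g [set x in take m s] (drop m s))
   / (#|U|`!)%:R
  = \sum_(H : {set U}) subset_prob p H *
      ((\sum_(b <- permutations (enum (~: H))) g H b) / (#|~: H|`!)%:R).
Proof.
rewrite exchange_big /=.
have prefix_sum (m : 'I_#|U|.+1) :
    \sum_(s <- permutations (enum U)) g [set x in take m s] (drop m s) =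
    \sum_(H : {set U} | #|H| == m) (m`!)%:R * \sum_(b <- permutations (enum (~: H))) g H b.
  rewrite big_seq (partition_big (fun s => [set x in take m s]) (fun H : {set U} => #|H| == m)) /=.
  - apply: eq_bigr => H /eqP Hm; rewrite -Hm -big_seq_cond -big_filter.
    rewrite (perm_big _ (permutations_prefix H)) big_allpairs_dep /= big_seq.
    rewrite (eq_bigr (fun=> \sum_(b <- permutations (enum (~: H))) g H b)).
      rewrite -big_seq big_const_seq count_predT size_permutations ?enum_uniq //.
      by rewrite -cardE iter_addr_0 mulr_natl.
    move=> a; rewrite mem_permutations => aP; apply: eq_bigr => b _.
    have sa : size a = #|H| by rewrite (perm_size aP) -cardE.
    rewrite take_size_cat // drop_size_cat //; congr (g _ _).
    by apply/setP=> x; rewrite inE (perm_mem aP) mem_enum.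
  - move=> s; rewrite mem_permutations => sU.
    have us : uniq s by rewrite (perm_uniq sU) enum_uniq.
    have -> : #|[set x in take m s]| = size (take m s).
      by rewrite -(card_uniqP (take_uniq m us)); apply: eq_card => x; rewrite inE.
    by rewrite size_takel // (perm_size sU) -cardE -ltnS.
transitivity (\sum_(m < #|U|.+1) \sum_(H : {set U} | #|H| == m)
   ('C(#|U|, m)%:R * p ^+ m * (1 - p) ^+ (#|U| - m)) *
     ((m`!)%:R * (\sum_(b <- permutations (enum (~: H))) g H b)) / (#|U|`!)%:R).
  rewrite mulr_suml; apply: eq_bigr => m _.
  by rewrite -mulr_sumr prefix_sum -mulr_suml -mulr_sumr.
rewrite (exchange_big_dep xpredT) //=; apply: eq_bigr => H _.
have HU : (#|H| < #|U|.+1)%N by rewrite ltnS max_card.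
rewrite (big_pred1 (Ordinal HU)) /=; last by move=> m /=; rewrite -(inj_eq val_inj) /= eq_sym.
rewrite subset_probE; have -> : (#|~: H| = #|U| - #|H|)%N by rewrite [LHS]cardsCs setCK.
have := bin_fact (HU : (#|H| <= #|U|)%N); move/(congr1 (fun n => n%:R : R)); rewrite !natrM => <-.
have nz k : (k`!)%:R != 0 :> R by rewrite pnatr_eq0 -lt0n fact_gt0.
have nzb : ('C(#|U|, #|H|))%:R != 0 :> R by rewrite pnatr_eq0 -lt0n bin_gt0.
by field; rewrite !nz nzb.
Qed.

(* Exchanging two items of [A] shows that all of them have equally many late
   permutations, and in each permutation exactly [#|A| - mu] are late. *)
Lemma late_permutations (S A : {set U}) (mu : nat) e :
  A \subset S -> e \in A ->
  \sum_(b <- permutations (enum S)) (mu <= index e [seq x <- b | x \in A])%N%:R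
  = ell R mu #|A| * (#|S|`!)%:R.
Proof.
move=> AS eA; pose late x b : R := (mu <= index x [seq y <- b | y \in A])%N%:R.
have sym x : x \in A -> \sum_(b <- permutations (enum S)) late x b =
    \sum_(b <- permutations (enum S)) late e b.
  move=> xA; pose t := tperm e x.
  have tA y : (t y \in A) = (y \in A) by rewrite /t; case: tpermP => // ->; rewrite eA xA.
  have tS y : (t y \in S) = (y \in S).
    by rewrite /t; case: tpermP => // ->; rewrite !(subsetP AS).
  have permt : perm_eq (permutations (enum S)) (map (map t) (permutations (enum S))).
    apply: uniq_perm; rewrite ?permutations_uniq ?map_inj_uniq ?permutations_uniq //.
      by apply: inj_map; exact: perm_inj.
    have permS b : perm_eq b (enum S) -> perm_eq (map t b) (enum S).
      move=> bS; apply: uniq_perm; rewrite ?enum_uniq //.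
        by rewrite map_inj_uniq ?(perm_uniq bS) ?enum_uniq //; exact: perm_inj.
      move=> y; rewrite mem_enum -[y](tpermK e x) -/t mem_map; last exact: perm_inj.
      by rewrite (perm_mem bS) mem_enum !tS.
    have tt b : map t (map t b) = b.
      by rewrite -map_comp -[RHS]map_id; apply: eq_map => y; rewrite /= tpermK.
    move=> b; rewrite mem_permutations; apply/idP/mapP => [bS|[c cS ->]].
      by exists (map t b); rewrite ?tt // mem_permutations permS.
    by rewrite permS // -mem_permutations.
  rewrite (perm_big _ permt) big_map; apply: eq_bigr => b _; rewrite /late.
  rewrite filter_map; have -> : [seq y <- b | preim t (mem A) y] = [seq y <- b | y \in A].
    by apply: eq_filter => y; rewrite /= tA.
  by rewrite -{1}[x](tpermL e x) -/t index_map //; exact: perm_inj.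
have total b : b \in permutations (enum S) -> \sum_(x in A) late x b = (#|A| - mu)%:R.
  rewrite mem_permutations => bS; set a := [seq y <- b | y \in A].
  have ua : uniq a by rewrite filter_uniq // (perm_uniq bS) enum_uniq.
  have memA : a =i A.
    move=> y; rewrite mem_filter (perm_mem bS) mem_enum andb_idr //.
    by move/(subsetP AS).
  have sa : size a = #|A| by rewrite -(card_uniqP ua); apply: eq_card.
  rewrite -(eq_bigl _ _ memA) -big_uniq //= (big_nth e) sa.
  rewrite (eq_big_nat _ _ (F2 := fun i => (mu <= i)%N%:R)); last first.
    by move=> i /andP[_ iA]; rewrite /late -/a index_uniq ?sa.
  rewrite -natr_sum; congr (_%:R); elim: (#|A|) => [|k IH]; first by rewrite big_geq.
  rewrite big_nat_recr //= IH; case: leqP; lia.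
have A0 : #|A|%:R != 0 :> R by rewrite pnatr_eq0 -lt0n; apply/card_gt0P; exists e.
apply: (mulfI A0); transitivity (\sum_(x in A) \sum_(b <- permutations (enum S)) late x b).
  by rewrite (eq_bigr _ sym) sumr_const mulr_natl.
rewrite exchange_big big_seq (eq_bigr _ total) -big_seq big_const_seq count_predT.
rewrite size_permutations ?enum_uniq // -cardE iter_addr_0 /ell.
by rewrite mulrA mulrCA mulfV // mulr1 mulr_natr.
Qed.

End RandomOrder.

(** * The online algorithm *)

Section Accept.
Variables (U : finType) (indep : {set U} -> bool) (a : pred U).

Definition accept (A : {set U}) (b : seq U) : {set U} :=
  foldl (fun A e => if a e && indep (e |: A) then e |: A else A) A b.

Lemma accept_indep A b : indep A -> indep (accept A b).
Proof. by elim: b A => //= e b IH A iA; apply: IH; case: ifP => // /andP[]. Qed.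

Lemma sub_accept (A : {set U}) b : A \subset accept A b.
Proof.
elim: b A => //= e b IH A; apply: subset_trans (IH _); case: ifP => // _.
exact: subsetUr.
Qed.

Lemma accept_sub (A : {set U}) b : accept A b \subset A :|: [set x in b | a x].
Proof.
elim: b A => [|e b IH] A /=; first exact: subsetUl.
apply: subset_trans (IH _) _; apply/subsetP=> x; rewrite !inE.
case: ifP => [/andP[ae _]|_]; rewrite ?inE.
  by case/orP=> [/orP[/eqP->|->]|/andP[-> ->]]; rewrite ?eqxx ?ae ?orbT.
by case/orP=> [->|/andP[-> ->]]; rewrite ?orbT.
Qed.

Variables (F : {set {set U}}) (mu : {set U} -> nat).
Hypothesis indepE : forall T, indep T = lam_indep F mu T.

(** A refusal needs a full [B], and whatever was accepted in [B] so far is among the earlier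
    arrivals in [B] satisfying [a], which the index counts. *)
Lemma mem_accept b e : uniq b -> e \in b -> a e ->
  (forall B, B \in F -> e \in B -> (index e [seq x <- b | a x & x \in B] < mu B)%N) ->
  e \in accept set0 b.
Proof.
move=> ub eb ae room; case/splitPr: eb ub room => b1 b2.
rewrite cat_uniq /= negb_or => /and3P[_ /andP[eb1 _] _] room.
rewrite /accept foldl_cat /= -/(accept set0 b1) ae.
have i1 : indep (accept set0 b1) by rewrite accept_indep // indepE lam_indep0.
have -> /= : indep (e |: accept set0 b1).
  rewrite indepE; apply/forall_inP=> B BF.
  have [eB|eB] := boolP (e \in B); last first.
    have -> : (e |: accept set0 b1) :&: B = accept set0 b1 :&: B by apply: setU1I_notin.
    by move: i1; rewrite indepE => /forall_inP; apply.
  have := room B BF eB; rewrite filter_cat /= ae eB /= index_cat /= eqxx addn0.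
  rewrite mem_filter (negbTE eb1) andbF => lt_mu.
  have -> : (e |: accept set0 b1) :&: B = e |: (accept set0 b1 :&: B) by apply: setU1I_mem.
  apply: leq_trans lt_mu; rewrite cardsU1 -add1n leq_add ?leq_b1 //.
  apply: leq_trans (card_size _); apply: subset_leq_card; apply/subsetP=> x.
  rewrite inE => /andP[/(subsetP (accept_sub _ _))]; rewrite !inE /=.
  by move=> /andP[xb1 ax] xB; rewrite mem_filter ax xB.
by apply: (subsetP (sub_accept _ _)); rewrite !inE eqxx.
Qed.

End Accept.

(** * Assembly of the competitive ratio *)

Section Competitive.
Variables (R : realFieldType) (U : finType) (F : {set {set U}}) (mu : {set U} -> nat).
Variables (w : U -> R) (rk : U -> nat) (indep : {set U} -> bool).
Hypothesis lamF : laminar F.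
Hypothesis w_ge0 : forall e, 0 <= w e.
Hypothesis rk_inj : injective rk.
Hypothesis indepE : forall T, indep T = lam_indep F mu T.

Let p : R := 5%:R / 6%:R.
Let ess := essential F mu.
Let N := selectable w rk indep.
Local Notation G := (greedy indep (linf w) rk).
Local Notation P := (subset_prob p).

Let indep0 : indep set0. Proof. by rewrite indepE lam_indep0. Qed.

Let indepS (A B : {set U}) : A \subset B -> indep B -> indep A.
Proof. by rewrite !indepE; apply: lam_indepS. Qed.

Let p01 : 0 <= p <= 1. Proof. by rewrite /p; lra. Qed.

(** A union bound for each element: one that is selectable but not accepted is late in some
    essential set, so its factor is at most [0]; for an accepted one the factor is at most [1]. *)
Lemma accept_weight (H : {set U}) b : perm_eq b (enum (~: H)) ->
  \sum_(e in N H) w e * (1 - \sum_(B in ess | e \in B)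
      (mu B <= index e [seq x <- b | x \in N H :&: B])%N%:R)
  <= linf w (accept indep (fun e => G (e |: H) != G H) set0 b).
Proof.
move=> bH; set A := accept _ _ _ _.
have ub : uniq b by rewrite (perm_uniq bH) enum_uniq.
have memb e : (e \in b) = (e \notin H) by rewrite (perm_mem bH) mem_enum inE.
have aN e : e \in b -> (G (e |: H) != G H) = (e \in N H).
  by rewrite memb => eH; rewrite greedy_changesE.
rewrite big_mkcond /linf [leRHS]big_mkcond; apply: ler_sum => e _.
have [eN|eN] := ifP; last by case: ifP.
have eb : e \in b by rewrite memb; move: eN; rewrite inE => /andP[].
set s := \sum_(B in ess | _) _.
have s0 : 0 <= s by apply: sumr_ge0 => B _; rewrite ler0n.
have [eA|eA] := ifP; first by rewrite ler_piMr // gerBl.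
rewrite mulr_ge0_le0 // subr_le0.
have [/existsP[B /and3P[Bess eB late]]|] :=
  boolP [exists B, [&& B \in ess, e \in B & (mu B <= index e [seq x <- b | x \in N H :&: B])%N]].
  rewrite /s (bigD1 B) ?Bess //= late lerDl; apply: sumr_ge0 => C _; exact: ler0n.
rewrite negb_exists => /forallP early; move/negP: eA; case.
apply: (@mem_accept _ _ _ ess mu) => //.
- by move=> T; rewrite indepE lam_indep_essential.
- by rewrite aN.
move=> B Bess eB; have := early B; rewrite Bess eB /= -ltnNge; congr (index e _ < _)%N.
by apply: eq_in_filter => x xb /=; rewrite inE aN.
Qed.

(** Given [H], the set [N H] does not depend on the order of the remaining arrivals, so
    [late_permutations] averages each lateness indicator. *)
Lemma expected_accept (H : {set U}) :
  linf w (N H) - \sum_(B in ess) linf w (N H :&: B) * ell R (mu B) #|N H :&: B|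
  <= (\sum_(b <- permutations (enum (~: H)))
       linf w (accept indep (fun e => G (e |: H) != G H) set0 b)) / (#|~: H|`!)%:R.
Proof.
have fact_pos : 0 < (#|~: H|`!)%:R :> R by rewrite ltr0n fact_gt0.
rewrite ler_pdivlMr //.
have NH : N H \subset ~: H by apply/subsetP=> x; rewrite !inE => /andP[].
pose low b := \sum_(e in N H) w e * (1 - \sum_(B in ess | e \in B)
      (mu B <= index e [seq x <- b | x \in N H :&: B])%N%:R).
apply: (@le_trans _ _ (\sum_(b <- permutations (enum (~: H))) low b)); last first.
  rewrite big_seq [leRHS]big_seq; apply: ler_sum => b.
  by rewrite mem_permutations => /accept_weight.
have cst (c : R) : \sum_(b <- permutations (enum (~: H))) c = c * (#|~: H|`!)%:R.
  rewrite big_const_seq count_predT size_permutations ?enum_uniq // -cardE.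
  by rewrite iter_addr_0 mulr_natr.
rewrite exchange_big /=.
have -> : \sum_(e in N H) \sum_(b <- permutations (enum (~: H)))
    w e * (1 - \sum_(B in ess | e \in B)
      (mu B <= index e [seq x <- b | x \in N H :&: B])%N%:R) =
  \sum_(e in N H) (w e - \sum_(B in ess | e \in B) w e * ell R (mu B) #|N H :&: B|)
     * (#|~: H|`!)%:R.
  apply: eq_bigr => e eN; rewrite -mulr_sumr sumrB cst mul1r exchange_big /=.
  rewrite (eq_bigr (fun B => ell R (mu B) #|N H :&: B| * (#|~: H|`!)%:R)); last first.
    move=> B /andP[_ eB]; apply: late_permutations; last by rewrite inE eN.
    by apply: subset_trans NH; apply: subsetIl.
  by rewrite -mulr_suml -mulr_sumr; ring.
rewrite -mulr_suml ler_pM2r // sumrB lerD2l lerN2 (exchange_big_dep (mem ess)) /=; last first.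
  by move=> e B _ /andP[].
apply: ler_sum => B Bess; rewrite -mulr_suml; apply: ler_wpM2r.
  by rewrite /ell divr_ge0 ?ler0n.
rewrite /linf le_eqVlt; apply/orP; left; apply/eqP; apply: eq_bigl => e.
by rewrite in_setI Bess.
Qed.

(** The potential bounds this mean by its initial value, which is [0]: no tail has been seen yet and
    [phi 0 0 = 0]. *)
Lemma expected_loss B : B \in ess ->
  \sum_(H : {set U}) P H * (linf w (N H :&: B) * (ell R (mu B) #|N H :&: B| - loss R (mu B)))
  <= 0.
Proof.
move=> Bess; have [lam [phi cert]] := loss_certificate R (mu B).
pose g (MN : {set U} * {set U}) :=
  linf w (MN.2 :&: B) * (ell R (mu B) #|MN.2 :&: B| - loss R (mu B)).
rewrite (eq_bigr (fun H => P H * g (scan indep (by_weight w rk) H set0 set0))); last first.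
  by move=> H _; rewrite scan_greedy.
rewrite expect_scan ?by_weight_uniq //.
have indepB T : indep T -> (#|T :&: B| <= mu B)%N.
  by rewrite indepE => /forall_inP; apply; move: Bess; rewrite inE => /andP[].
have w0 : 0 <= \sum_x w x by apply: sumr_ge0.
apply: le_trans (scan_mean_potential p01 w_ge0 indepB cert indep0 (by_weight_uniq w rk) _
  (by_weight_sorted w rk) w0 _) _.
- by move=> e _; rewrite !inE.
- by move=> e _; rewrite (bigD1 e) //= lerDl sumr_ge0.
by rewrite !set0I cards0 (cert_phi0 cert) mulr0 addr0 /linf big_set0 mul0r.
Qed.

(** The balance gives the factor [(1 - p) / p], and optimality of greedy against [T :&: H] gives
    [p]; the product is [1 - p = 1 / 6]. *)
Lemma expected_selectable T : indep T ->
  linf w T / 6%:R <= \sum_(H : {set U}) P H * linf w (N H).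
Proof.
move=> iT; set EN := \sum_(H : {set U}) _.
pose EM := \sum_(H : {set U}) P H * linf w (G H).
have balance : p * EN - (1 - p) * EM = 0.
  pose g (MN : {set U} * {set U}) := p * linf w MN.2 - (1 - p) * linf w MN.1.
  transitivity (\sum_(H : {set U}) P H * g (scan indep (by_weight w rk) H set0 set0)).
    rewrite !mulr_sumr -sumrB; apply: eq_bigr => H _; rewrite scan_greedy // /g /=; ring.
  rewrite expect_scan ?by_weight_uniq // scan_mean_balance ?by_weight_uniq //.
    by rewrite /linf !big_set0 !mulr0 subrr.
  by move=> e _; rewrite !inE.
have optM : p * linf w T <= EM.
  rewrite -expect_linf; apply: ler_sum => H _; apply: ler_wpM2l.
    exact: subset_prob_ge0.
  apply: (greedy_optimal lamF) => //; last exact: subsetIr.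
  by apply: indepS iT; apply: subsetIl.
by move: balance optM; rewrite /p; lra.
Qed.

Lemma online_competitive T : indep T ->
  linf w T / (96%:R / 10%:R) <= expected_online indep (linf w) rk p.
Proof.
move=> iT; rewrite /expected_online.
rewrite (expected_prefix p (fun H b =>
  linf w (accept indep (fun e => G (e |: H) != G H) set0 b))).
apply: (@le_trans _ _ (\sum_(H : {set U}) P H *
  (linf w (N H) - \sum_(B in ess) linf w (N H :&: B) * ell R (mu B) #|N H :&: B|))); last first.
  by apply: ler_sum => H _; rewrite ler_wpM2l ?subset_prob_ge0 ?expected_accept.
(* Summed by elements instead of sets, each [e] is charged [loss] at distinct capacities, hence at
   most [3 / 8] in total. *)
have chain H : \sum_(B in ess) loss R (mu B) * linf w (N H :&: B) <= 3%:R / 8%:R * linf w (N H).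
  have -> : \sum_(B in ess) loss R (mu B) * linf w (N H :&: B) =
      \sum_(e in N H) (\sum_(B in ess | e \in B) loss R (mu B)) * w e.
    under [RHS]eq_bigr do rewrite mulr_suml.
    rewrite (exchange_big_dep (mem ess)) /=; last by move=> e B _ /andP[].
    apply: eq_bigr => B Bess; rewrite /linf mulr_sumr; apply: eq_bigl => e.
    by rewrite in_setI Bess.
  rewrite /linf mulr_sumr; apply: ler_sum => e _; apply: ler_wpM2r => //.
  apply: (sum_injective_le (m := mu) _ (loss_ge0 R) (sum_loss R)).
  exact: essential_inj.
(* The constant [9.6] arises here, as [1 / 6 * 5 / 8 = 10 / 96]. *)
apply: (@le_trans _ _ (5%:R / 8%:R * \sum_(H : {set U}) P H * linf w (N H))).
  by have := expected_selectable iT; lra.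
have lossE : \sum_(B in ess) \sum_(H : {set U})
    P H * (linf w (N H :&: B) * (ell R (mu B) #|N H :&: B| - loss R (mu B))) <= 0.
  by apply: sumr_le0 => B; apply: expected_loss.
rewrite -subr_ge0; apply: le_trans (_ : 0 <= - _) _; first by rewrite oppr_ge0; exact: lossE.
rewrite exchange_big /= mulr_sumr -sumrB -sumrN; apply: ler_sum => H _.
rewrite -mulr_sumr -mulrN [5%:R / 8%:R * (_ * _)]mulrCA -mulrBr.
apply: ler_wpM2l; first exact: subset_prob_ge0.
have -> : \sum_(B in ess) linf w (N H :&: B) * (ell R (mu B) #|N H :&: B| - loss R (mu B)) =
    \sum_(B in ess) linf w (N H :&: B) * ell R (mu B) #|N H :&: B| -
    \sum_(B in ess) loss R (mu B) * linf w (N H :&: B).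
  by rewrite -sumrB; apply: eq_bigr => B _; ring.
by have := chain H; lra.
Qed.

End Competitive.

Theorem theorem3 (R : realFieldType) :
  exists p : R, 0 < p < 1 /\
  forall (U : finType) (F : {set {set U}}) (mu : {set U} -> nat)
         (w : U -> R) (rk : U -> nat),
    laminar F ->
    (forall e, 0 <= w e) ->
    injective rk ->
    let indep := lam_indep F mu in
    let f := linf w in
    (forall s m, indep (online indep f rk s m)) /\
    (forall T : {set U}, indep T ->
       f T / (96%:R / 10%:R) <= expected_online indep f rk p).
Proof.
exists (5%:R / 6%:R); split; first by lra.
move=> U F mu w rk lamF w_ge0 rk_inj indep f; split=> [s m|T iT].
  by apply: accept_indep; apply: lam_indep0.
exact: (online_competitive lamF).
Qed.
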